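(* If $(X,d_1)$ and $(Y,d_2)$ are unbounded proximally coarse equivalent metric spaces, then their corresponding proximity spaces at infinity $\mathbf{B}X$ and $\mathbf{B}Y$ are proximally isomorphic. In particular, they are homeomorphic (with respect to the topologies induced by their proximities).
   Context: Here $\mathbb{N}=\{1,2,\dots\}$. Metric coarse proximity. For subsets $A,B$ of a metric space $(X,d)$ put $d(A,B)=\inf\{d(x,y)\mid x\in A, y\in B\}$, with $\inf\emptyset=\infty$. Write $A\,\mathbf{b}\,B$ if there exists $\epsilon<\infty$ such that for all bounded sets $D\subseteq X$, $d(A\setminus D,B\setminus D)<\epsilon$; $\bar{\mathbf{b}}$ denotes the negation of $\mathbf{b}$. Write $A\ll B$ if $A\,\bar{\mathbf{b}}\,(X\setminus B)$. Write $A\,\phi\,B$ if $A\,\mathbf{b}\,B'$ for every unbounded $B'\subseteq B$ and $A'\,\mathbf{b}\,B$ for every unbounded $A'\subseteq A$; $\phi$ is an equivalence relation on the power set of $X$ (for nonempty sets it is the relation of having finite Hausdorff distance). Maps. A function $f:X\to Y$ between metric spaces is a coarse proximity map if it sends bounded sets to bounded sets and $A\,\mathbf{b}\,B$ in $X$ implies $f(A)\,\mathbf{b}\,f(B)$ in $Y$. Two functions $f,g:X\to Y$ are close, $f\sim g$, if $f(A)\,\phi\,g(A)$ for all $A\subseteq X$. The spaces $X$ and $Y$ are proximally coarse equivalent if there are coarse proximity maps $f:X\to Y$ and $g:Y\to X$ such that $g\circ f\sim \mathrm{id}_X$ and $f\circ g\sim\mathrm{id}_Y$. Proximities. A proximity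 on a set $Z$ is a relation $\delta$ on the power set of $Z$ such that for all $A,B,C\subseteq Z$ (with $\bar\delta$ the negation of $\delta$): (i) $A\delta B$ implies $B\delta A$; (ii) $(A\cup B)\delta C$ iff $A\delta C$ or $B\delta C$; (iii) $A\delta B$ implies $A,B\neq\emptyset$; (iv) $A\bar\delta B$ implies that there exists $E\subseteq Z$ with $A\bar\delta E$ and $(Z\setminus E)\bar\delta B$; (v) $A\cap B\neq\emptyset$ implies $A\delta B$. The topology induced by $\delta$ is given by the closure operator $cl(A)=\{x\in Z\mid\{x\}\delta A\}$. A function $f:(Z,\delta_1)\to(W,\delta_2)$ is a proximity map if $A\delta_1B$ implies $f(A)\delta_2f(B)$; a proximity isomorphism is a bijective proximity map whose inverse is a proximity map. A proximity $\delta_1$ is finer than $\delta_2$ (on the same set) if $A\delta_1B$ implies $A\delta_2B$. For a surjection $f$ from a proximity space $(Z,\delta)$ onto a set $W$, the quotient proximity on $W$ is the finest proximity on $W$ for which $f$ is a proximity map (it always exists). Proximity space at infinity. A sequence $f:\mathbb{N}\to\mathbb{R}$ is adequate if it is positive and $f(n)-f(n-1)>n+1$ for all $n>1$. For $A\subseteq X$, $x_0\in X$ and $f$ adequate, put $U_{x_0}(A,f)=A\cup\bigcup_{n\geq1}\big(\mathscr{B}(A,n)\setminus\mathscr{B}(x_0,f(n))\big)$, where $\mathscr{B}(x,r)$ is the open ball and $\mathscr{B}(A,r)=\bigcup_{x\in A}\mathscr{B}(x,r)$. Let $\mathcal{H}_\infty(X)$ be the set of unbounded subsets of $X$, with the proximity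 $\delta$ defined by: $\mathcal{A}\,\delta\,\mathcal{C}$ iff for every adequate $f$ there are $A\in\mathcal{A}$, $C\in\mathcal{C}$ with $A\ll U_{x_0}(C,f)$ and $C\ll U_{x_0}(A,f)$ (this proximity does not depend on the choice of $x_0$). Let $\mathbf{B}X$ be the set of $\phi$-equivalence classes $[A]$ of unbounded sets $A\subseteq X$, endowed with the quotient proximity $\boldsymbol{\delta}$ induced by the projection $\pi:(\mathcal{H}_\infty(X),\delta)\to\mathbf{B}X$, $A\mapsto[A]$. The pair $(\mathbf{B}X,\boldsymbol{\delta})$ is the proximity space at infinity of $X$. *)

(* Defs.v *)
From HB Require Import structures.
From mathcomp Require Import all_boot all_order all_algebra.
From mathcomp Require Import all_classical all_reals all_analysis.
From mathcomp Require Import lra.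
Set Implicit Arguments.
Unset Strict Implicit.
Unset Printing Implicit Defensive.
Import Order.TTheory GRing.Theory Num.Theory.
Local Open Scope classical_set_scope.
Local Open Scope ring_scope.
Local Open Scope quotient_scope.

Record proximity (Z : Type) := Proximity {
  prox_rel :> set Z -> set Z -> Prop ;
  proxC : forall A B, prox_rel A B -> prox_rel B A ;
  proxU : forall A B C, prox_rel (A `|` B) C <-> prox_rel A C \/ prox_rel B C ;
  prox_neq0 : forall A B, prox_rel A B -> A !=set0 /\ B !=set0 ;
  prox_strong : forall A B, ~ prox_rel A B ->
    exists E : set Z, ~ prox_rel A E /\ ~ prox_rel (~` E) B ;
  prox_meet : forall A B, A `&` B !=set0 -> prox_rel A B }.

Definition proximity_map (Z W : Type) (d1 : proximity Z) (d2 : proximity W)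
  (f : Z -> W) : Prop := forall A B, d1 A B -> d2 (f @` A) (f @` B).

Definition proximity_isomorphism (Z W : Type) (d1 : proximity Z)
    (d2 : proximity W) (h : Z -> W) : Prop :=
  proximity_map d1 d2 h /\
  exists g : W -> Z, [/\ cancel h g, cancel g h & proximity_map d2 d1 g].

Definition proximally_isomorphic (Z W : Type) (d1 : proximity Z)
  (d2 : proximity W) : Prop := exists h : Z -> W, proximity_isomorphism d1 d2 h.

Definition finer (Z : Type) (d1 d2 : proximity Z) : Prop :=
  forall A B, d1 A B -> d2 A B.

Definition is_quotient_proximity (Z W : Type) (d : proximity Z) (f : Z -> W)
    (e : proximity W) : Prop :=
  proximity_map d e f /\
  forall e' : proximity W, proximity_map d e' f -> finer e e'.

Section proximity_theory.
Context {Z : Type} (d : proximity Z).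

Lemma prox_subl A A' B : A `<=` A' -> d A B -> d A' B.
Proof. by move=> /setUidPr <- AB; apply/proxU; left. Qed.

Lemma prox_sub A A' B B' : A `<=` A' -> B `<=` B' -> d A B -> d A' B'.
Proof. by move=> sA sB /(prox_subl sA)/proxC/(prox_subl sB)/proxC. Qed.

Lemma proxUr A B C : d A (B `|` C) <-> d A B \/ d A C.
Proof.
split=> [/proxC/proxU[]/proxC|]; [by left|by right|].
by case=> /proxC AB; apply: proxC; apply/proxU; [left|right].
Qed.

Definition prox_closure (A : set Z) : set Z := [set x | d [set x] A].

Lemma sub_prox_closure A : A `<=` prox_closure A.
Proof. by move=> x Ax; apply: prox_meet; exists x. Qed.

Lemma prox_closure_id A : prox_closure (prox_closure A) = prox_closure A.
Proof.
apply/seteqP; split; last exact: sub_prox_closure.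
move=> x; apply: contraPP => /prox_strong[E [xE EA]].
move=> /(prox_sub (@subset_refl _ _)) H; apply/xE/H => y yA.
apply: contrapT => Ey; apply: EA; apply: prox_subl yA.
by move=> _ ->.
Qed.

End proximity_theory.

(** Topology of a proximity: the closed sets are the fixed points of
    [prox_closure]; see [closure_prox] below. *)
Definition prox_space (Z : choiceType) (d : proximity Z) : Type := Z.

Section prox_topology.
Context {Z : choiceType} (d : proximity Z).

HB.instance Definition _ := Choice.on (prox_space d).

Definition prox_open (U : set (prox_space d)) : Prop :=
  prox_closure d (~` U) = ~` U.

Let prox_openP U : prox_open U <-> forall x, d [set x] (~` U) -> ~ U x.
Proof.
split=> [UE x xU|h]; first by have: (~` U) x by rewrite -UE.
by apply/seteqP; split => [x /h//|]; exact: sub_prox_closure.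
Qed.

Let prox_openT : prox_open setT.
Proof. by apply/prox_openP => x /prox_neq0[_ []]; rewrite setCT. Qed.

Let prox_openI A B : prox_open A -> prox_open B -> prox_open (A `&` B).
Proof.
move=> /prox_openP oA /prox_openP oB; apply/prox_openP => x.
by rewrite setCI => /proxUr[/oA nA []|/oB nB []].
Qed.

Let prox_open_bigcup I (f : I -> set (prox_space d)) :
  (forall i, prox_open (f i)) -> prox_open (\bigcup_i f i).
Proof.
move=> of_; apply/prox_openP => x xf [i _ fix_].
have /prox_openP := of_ i; move=> /(_ x); apply => //.
by apply: prox_sub xf => // y nfy fiy; apply: nfy; exists i.
Qed.

HB.instance Definition _ := @isOpenTopological.Build (prox_space d)
  prox_open prox_openT prox_openI prox_open_bigcup.

Lemma closure_prox (A : set (prox_space d)) : closure A = prox_closure d A.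
Proof.
apply/seteqP; split.
  rewrite closureE; apply: smallest_sub; last exact: sub_prox_closure.
  rewrite -openC; rewrite /open/= /prox_open setCK.
  exact: prox_closure_id.
move=> x xA.
suff : prox_closure d (closure A) x.
  have : open (~` closure A) by rewrite openC; exact: closed_closure.
  by rewrite {1}/open/= /prox_open setCK => ->.
exact: (prox_sub (@subset_refl _ _) (@subset_closure (prox_space d) A) xA).
Qed.

End prox_topology.

Definition homeomorphic (S T : topologicalType) : Prop :=
  exists (h : S -> T) (g : T -> S),
    [/\ cancel h g, cancel g h, continuous h & continuous g].

Section quotient_proximity.
Context {Z W : Type} (d : proximity Z) (f : Z -> W).

(** The quotient proximity is the join of all the proximities making [f] a
    proximity map: two sets are far when they can be cut into finitely many
    pieces that are pairwise far for some member of the family. *)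
Inductive far : set W -> set W -> Prop :=
| far_base (e : proximity W) A B :
    proximity_map d e f -> ~ e A B -> far A B
| far_sym A B : far A B -> far B A
| far_union A A' B : far A B -> far A' B -> far (A `|` A') B.

Let far_sub A B : far A B ->
  forall A' B', A' `<=` A -> B' `<=` B -> far A' B'.
Proof.
elim=> {A B} [e A B ef AB|A B _ ih|A1 A2 B _ ih1 _ ih2] A' B' sA sB.
- by apply: (far_base ef) => /(prox_sub sA sB).
- by apply: far_sym; exact: ih.
- rewrite -(setIidl sA) setIUr.
  by apply: far_union; [apply: ih1|apply: ih2] => //; exact: subIsetr.
Qed.

Let far_disj A B : far A B -> ~ (A `&` B !=set0).
Proof.
elim=> {A B} [e A B _ AB|A B _ ih|A1 A2 B _ ih1 _ ih2].
- by move=> /(prox_meet e).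
- by rewrite setIC.
- by move=> [x [[A1x|A2x] Bx]]; [apply: ih1|apply: ih2]; exists x.
Qed.

Let far_pre A B : far A B -> ~ d (f @^-1` A) (f @^-1` B).
Proof.
elim=> {A B} [e A B ef AB|A B _ ih|A1 A2 B _ ih1 _ ih2].
- by move=> /ef /(prox_sub (@image_preimage_subset _ _ _ _)
    (@image_preimage_subset _ _ _ _)).
- by move=> /proxC.
- by rewrite preimage_setU => /proxU[].
Qed.

Let far_strong A B : far A B -> exists E, far A E /\ far (~` E) B.
Proof.
elim=> {A B} [e A B ef /prox_strong[E [AE EB]]|A B _ [E [AE EB]]|
    A1 A2 B _ [E1 [A1E E1B]] _ [E2 [A2E E2B]]].
- by exists E; split; apply: (far_base ef).
- by exists (~` E); split; [exact: far_sym|rewrite setCK; exact: far_sym].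
- exists (E1 `&` E2); split; last by rewrite setCI; exact: far_union.
  by apply: far_union; [exact: far_sub A1E _ _ _ (@subIsetl _ _ _)
                       |exact: far_sub A2E _ _ _ (@subIsetr _ _ _)].
Qed.

Let indiscrete : proximity W.
Proof.
exists (fun A B => A !=set0 /\ B !=set0).
- by move=> A B [].
- move=> A B C; split; last first.
    by case=> [[[x Ax] ?]|[[x Bx] ?]]; split => //; exists x; [left|right].
  by move=> [[x [Ax|Bx]] ?]; [left|right]; split => //; exists x.
- by [].
- move=> A B /not_andP[A0|B0].
    by exists setT; split; [case|rewrite setCT => -[[]]].
  by exists set0; split; [case=> _ []|case].
- by move=> A B [x [Ax Bx]]; split; exists x.
Defined.

Let indiscrete_map : proximity_map d indiscrete f.
Proof.
by move=> A B /prox_neq0[[x Ax] [y By]]; split; [exists (f x)|exists (f y)];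
  [exists x|exists y].
Qed.

Let near_proximity : proximity W.
Proof.
exists (fun A B => ~ far A B).
- by move=> A B AB BA; exact/AB/far_sym.
- move=> A B C; split.
    apply: contra_notP => /not_orP[/contrapT AC /contrapT BC].
    exact: far_union.
  by case=> nfar ABC; apply: nfar; apply: (far_sub ABC) => // x Hx; by [left|right].
- move=> A B AB; split; apply: contra_notP AB => h0.
    by apply: (far_base indiscrete_map) => -[].
  by apply: (far_base indiscrete_map) => -[].
- move=> A B /contrapT/far_strong[E [AE EB]]; exists E.
  by split=> H; exact: H.
- by move=> A B AB fAB; exact: far_disj fAB AB.
Defined.

Lemma quotient_proximity_exists : exists e, is_quotient_proximity d f e.
Proof.
exists near_proximity; split.
  move=> A B AB fAB; apply: (far_pre fAB).
  by apply: prox_sub AB; exact: preimage_image.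
move=> e ef A B; apply: contra_notP => AB; exact: (far_base ef).
Qed.

Definition quotient_proximity : proximity W :=
  projT1 (cid quotient_proximity_exists).

Lemma quotient_proximityP : is_quotient_proximity d f quotient_proximity.
Proof. exact: projT2 (cid quotient_proximity_exists). Qed.

End quotient_proximity.

Section coarse_proximity.
Context {R : realType} {X : metricType R}.
Implicit Types (A B C D E : set X) (x y z : X) (f : nat -> R).

Definition mbounded A : Prop :=
  exists M : R, forall x y, A x -> A y -> mdist x y <= M.

Definition set_dist A B : \bar R :=
  ereal_inf [set (mdist p.1 p.2)%:E | p in A `*` B].

Definition coarse_near A B : Prop :=
  exists eps : R, forall D, mbounded D ->
    (set_dist (A `\` D) (B `\` D) < eps%:E)%E.

Definition strongly_contained A B : Prop := ~ coarse_near A (~` B).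

Definition phi A B : Prop :=
  (forall B', B' `<=` B -> ~ mbounded B' -> coarse_near A B') /\
  (forall A', A' `<=` A -> ~ mbounded A' -> coarse_near A' B).

Definition ball_around A (r : R) : set X := \bigcup_(x in A) ball x r.

(** Sequences are indexed by the positive integers; [f 0] is irrelevant. *)
Definition adequate f : Prop :=
  (forall n, (1 <= n)%N -> 0 < f n) /\
  (forall n, (1 < n)%N -> f n - f n.-1 > n%:R + 1).

Definition Uset (x0 : X) A f : set X :=
  A `|` \bigcup_(n in [set n | (1 <= n)%N])
          (ball_around A n%:R `\` ball x0 (f n)).

Lemma coarse_nearP A B : coarse_near A B <->
  exists eps : R, forall D, mbounded D ->
    exists x y, [/\ A x, ~ D x, B y, ~ D y & mdist x y < eps].
Proof.
split=> -[eps h]; exists eps => D /h.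
  move=> /ereal_inf_lt[_ [[x y] /= [[Ax Dx] [By Dy]] <-]].
  by rewrite lte_fin => xy; exists x, y.
move=> [x [y [Ax Dx By Dy xy]]].
apply: (@le_lt_trans _ _ (mdist x y)%:E); last by rewrite lte_fin.
by apply: ereal_inf_lbound; exists (x, y).
Qed.

Lemma coarse_nearC A B : coarse_near A B -> coarse_near B A.
Proof.
move=> /coarse_nearP[e h]; apply/coarse_nearP; exists e => D /h.
by move=> [x [y [? ? ? ? ?]]]; exists y, x; split => //; rewrite metric_sym.
Qed.

Lemma mboundedP x0 A : mbounded A <-> exists r, A `<=` ball x0 r.
Proof.
split=> [[M h]|[r Ar]].
  have [[a Aa]|A0] := pselect (A !=set0); last first.
    by exists 0 => x Ax; case: A0; exists x.
  exists (mdist x0 a + M + 1) => x Ax; rewrite ballEmdist/=.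
  have := metric_triangle x0 a x; have := h a x Aa Ax; lra.
exists (r + r) => x y /Ar; rewrite ballEmdist/= => xr /Ar.
rewrite ballEmdist/= => yr.
have := metric_triangle x x0 y; rewrite (metric_sym x x0); lra.
Qed.

Lemma sub_mbounded A B : A `<=` B -> mbounded B -> mbounded A.
Proof. by move=> AB [M h]; exists M => x y /AB Bx /AB; exact: h. Qed.

Lemma mboundedU A B : mbounded A -> mbounded B -> mbounded (A `|` B).
Proof.
have [[x0 _]|X0] := pselect ([set: X] !=set0); last first.
  by move=> _ _; exists 0 => x; case: X0; exists x.
move=> /(mboundedP x0)[r Ar] /(mboundedP x0)[s Bs].
apply/(mboundedP x0); exists (Num.max r s) => x [/Ar|/Bs];
  by rewrite !ballEmdist/= lt_max => ->; rewrite ?orbT.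
Qed.

Lemma unboundedD A D : ~ mbounded A -> mbounded D -> exists2 x, A x & ~ D x.
Proof.
move=> uA bD; apply: contrapT => h; apply: uA; apply: sub_mbounded bD => x Ax.
by apply: contrapT => nDx; apply: h; exists x.
Qed.

Lemma phi_refl A : phi A A.
Proof.
split=> B BA uB; apply/coarse_nearP; exists 1 => D bD;
  have [x Bx Dx] := unboundedD uB bD; exists x, x;
  by rewrite mdistxx; split => //; exact: BA.
Qed.

Lemma phi_sym A B : phi A B -> phi B A.
Proof. by case=> h1 h2; split => C CA uC; apply: coarse_nearC; auto. Qed.

Let phi_transl A B C : phi A B -> phi B C ->
  forall C', C' `<=` C -> ~ mbounded C' -> coarse_near A C'.
Proof.
move=> [AB _] [BC _] C' C'C uC'.
have /coarse_nearP[e1 h1] := BC _ C'C uC'.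
pose B' := B `&` [set y | exists2 z, C' z & mdist y z < e1].
have uB' : ~ mbounded B'.
  move=> /h1[y [z [By B'y C'z _ yz]]]; apply: B'y; split => //.
  by exists z.
have /coarse_nearP[e2 h2] := AB _ (@subIsetl _ _ _) uB'.
apply/coarse_nearP; exists (e1 + e2) => D bD.
have [x0] : exists x0 : X, True.
  by have [y _ _] := unboundedD uB' bD; exists y.
have [r Dr] := (mboundedP x0 _).1 bD; move=> _.
have bD' : mbounded (ball x0 (Num.max r 0 + `|e1|)).
  by apply/(mboundedP x0); exists (Num.max r 0 + `|e1|).
have [x [y [Ax Dx [By [z C'z yz]] Dy xy]]] := h2 _ bD'.
have r0 : r <= Num.max r 0 by rewrite le_max lexx.
have e10 : e1 <= `|e1| := ler_norm e1.
have e1ge0 : 0 <= `|e1| := normr_ge0 e1.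
exists x, z; split => //.
- by move=> /Dr; move: Dx; rewrite !ballEmdist/= => /negP; rewrite -leNgt; lra.
- move=> /Dr; move: Dy; rewrite !ballEmdist/= => /negP; rewrite -leNgt.
  have := metric_triangle x0 z y; rewrite (metric_sym z y); lra.
- have := metric_triangle x y z; lra.
Qed.

Lemma phi_trans A B C : phi A B -> phi B C -> phi A C.
Proof.
move=> AB BC; split; first exact: phi_transl AB BC.
move=> A' A'A uA'; apply: coarse_nearC.
exact: phi_transl (phi_sym BC) (phi_sym AB) _ A'A uA'.
Qed.

Lemma strongly_containedP A B : strongly_contained A B <->
  forall eps : R, exists2 D, mbounded D &
    forall x y, A x -> ~ D x -> ~ B y -> ~ D y -> eps <= mdist x y.
Proof.
rewrite /strongly_contained; split.
  move=> AB eps; apply: contrapT => h; apply: AB; apply/coarse_nearP.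
  exists eps => D bD; apply: contrapT => h'; apply: h; exists D => //.
  move=> x y Ax Dx By Dy; rewrite leNgt; apply/negP => xy; apply: h'.
  by exists x, y.
move=> h /coarse_nearP[eps]; have [D bD hD] := h eps.
move=> /(_ D bD)[x [y [Ax Dx By Dy]]]; apply/negP; rewrite -leNgt.
exact: hD.
Qed.

Lemma strongly_contained_sub A B D : strongly_contained A B -> mbounded D ->
  forall C, B `<=` C `|` D -> strongly_contained A C.
Proof.
move=> /strongly_containedP AB bD C BCD; apply/strongly_containedP => eps.
have [D' bD' h] := AB eps; exists (D `|` D'); first exact: mboundedU.
move=> x y Ax /not_orP[_ D'x] Cy /not_orP[Dy D'y]; apply: h => // By.
by have [] := BCD _ By.
Qed.

Lemma strongly_contained_mod A B : strongly_contained A B ->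
  exists2 D, mbounded D & A `<=` B `|` D.
Proof.
move=> /strongly_containedP/(_ 1)[D bD h]; exists D => // x Ax.
have [Bx|Bx] := pselect (B x); first by left.
right; apply: contrapT => Dx.
by have := h x x Ax Dx Bx Dx; rewrite mdistxx ler10.
Qed.

Lemma Uset_anti x0 A f g : (forall n, (1 <= n)%N -> f n <= g n) ->
  Uset x0 A g `<=` Uset x0 A f.
Proof.
move=> fg x [Ax|[n n1 [An gx]]]; first by left.
right; exists n => //; split => // fx; apply: gx.
move: fx; rewrite !ballEmdist/= => /lt_le_trans; apply; exact: fg.
Qed.

Lemma adequate_max f g : adequate f -> adequate g ->
  adequate (fun n => Num.max (f n) (g n)).
Proof.
move=> [f0 f1] [g0 g1]; split=> n n1; first by rewrite lt_max f0.
have := f1 n n1; have := g1 n n1.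
by have [] := leP (f n) (g n); have [] := leP (f n.-1) (g n.-1); lra.
Qed.

Lemma adequate_double f : adequate f ->
  adequate (fun n => f n.*2 + n%:R).
Proof.
move=> [f0 f1]; split=> n n1.
  by rewrite ltr_wpDr// f0// double_gt0.
case: n n1 => [//|[//|n]] _ /=.
have h1 := f1 n.+2.*2 isT; have h2 := f1 n.+2.*2.-1 isT.
move: h1 h2; rewrite !doubleS /= -!natr1 -muln2 natrM.
have : 0 <= n%:R :> R by [].
lra.
Qed.

Lemma adequate_gt f n : adequate f -> (1 < n)%N -> n%:R < f n.
Proof.
move=> [f0 f1] n1; have := f1 n n1; have := f0 n.-1.
by case: n n1 => [//|[//|n]] _ /= /(_ isT); lra.
Qed.

Lemma Uset_Uset x0 E C f D : adequate f -> mbounded D ->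
  E `<=` Uset x0 C (fun n => f n.*2 + n%:R) `|` D ->
  exists2 D', mbounded D' &
    Uset x0 E (fun n => f n.*2 + n%:R) `<=` Uset x0 C f `|` D'.
Proof.
move=> af bD EC; have [r Dr] := (mboundedP x0 _).1 bD.
have UU : Uset x0 C (fun n => f n.*2 + n%:R) `<=` Uset x0 C f.
  move=> x [Cx|[n n1 [[c Cc cx] fx]]]; [by left|right; exists n.*2].
    by rewrite /= double_gt0.
  have : 0 <= n%:R :> R by [].
  split; first exists c => //.
    by move: cx; rewrite !ballEmdist/= -muln2 natrM; lra.
  by move: fx; rewrite !ballEmdist/=; lra.
exists (D `|` ball x0 (r + r)).
  by apply: mboundedU => //; apply/(mboundedP x0); exists (r + r).
move=> z [/EC[/UU|]|]; [by left|by right; left|].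
move=> [n /= n1 [[y Ey yz] fz]].
have n0 : 0 <= n%:R :> R by [].
move: yz fz; rewrite !ballEmdist/= => yz /negP; rewrite -leNgt => fz.
have tz := metric_triangle x0 y z.
case: (EC _ Ey) => [[Cy|[m /= m1 [[c Cc cy] fy]]]|/Dr].
- left; right; exists n.*2; first by rewrite /= double_gt0.
  split; first exists y => //; rewrite ballEmdist/=.
    by rewrite -muln2 natrM; lra.
  by apply/negP; rewrite -leNgt; lra.
- have m0 : 0 <= m%:R :> R by [].
  move: cy fy; rewrite !ballEmdist/= => cy /negP; rewrite -leNgt => fy.
  have tc := metric_triangle c y z; have ty := metric_triangle x0 z y.
  have yzs := metric_sym y z.
  have [mn|nm] := leqP m n.
    have mnR : m%:R <= n%:R :> R by rewrite ler_nat.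
    left; right; exists n.*2; first by rewrite /= double_gt0.
    split; first exists c => //; rewrite ballEmdist/=.
      by rewrite -muln2 natrM; lra.
    by apply/negP; rewrite -leNgt; lra.
  have mnR : n%:R <= m%:R :> R by rewrite ler_nat ltnW.
  left; right; exists m.*2; first by rewrite /= double_gt0.
  split; first exists c => //; rewrite ballEmdist/=.
    by rewrite -muln2 natrM; lra.
  by apply/negP; rewrite -leNgt; lra.
- rewrite ballEmdist/= => yr; right; right.
  have /(adequate_gt af) : (1 < n.*2)%N by case: n n1 {n0 yz fz} => // n.
  by rewrite -muln2 natrM => h; move: fz h; rewrite -muln2; lra.
Qed.

Lemma strongly_contained_trans x0 A E C f : adequate f ->
  let g := fun n => f n.*2 + n%:R in
  strongly_contained A (Uset x0 E g) -> strongly_contained E (Uset x0 C g) ->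
  strongly_contained A (Uset x0 C f).
Proof.
move=> af /= AE /strongly_contained_mod[D bD /(Uset_Uset af bD)[D' bD']].
exact: strongly_contained_sub AE bD' _.
Qed.

Lemma strongly_contained_Uset x0 A f : strongly_contained A (Uset x0 A f).
Proof.
apply/strongly_containedP => eps; pose n := (Num.truncn `|eps|).+1.
exists (ball x0 (f n)); first by apply/(mboundedP x0); exists (f n).
move=> x y Ax _ Uy Dy; rewrite leNgt; apply/negP => xy; apply: Uy; right.
exists n => //; split => //; exists x => //.
rewrite ballEmdist/=; apply: lt_trans xy _.
exact: le_lt_trans (ler_norm _) (truncnS_gt _).
Qed.

End coarse_proximity.

Section boundary.
Context {R : realType}.

Definition hyperspace_infty (X : metricType R) : choiceType :=
  [set A : set X | ~ mbounded A].

Definition hyperspace_near (X : metricType R) (x0 : X)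
    (P Q : set (hyperspace_infty X)) : Prop :=
  forall f : nat -> R, adequate f -> exists A C : hyperspace_infty X,
    [/\ P A, Q C, strongly_contained (val A) (Uset x0 (val C) f)
      & strongly_contained (val C) (Uset x0 (val A) f)].

Definition hyperspace_proximity (X : metricType R) (x0 : X) :
  proximity (hyperspace_infty X).
Proof.
exists (hyperspace_near x0).
- by move=> P Q PQ f /PQ[A [C [? ? ? ?]]]; exists C, A.
- move=> P P' Q; split; last first.
    by case=> PQ f /PQ[A [C [? ? ? ?]]]; exists A, C; split => //; [left|right].
  move=> PQ; apply: contrapT => /not_orP[].
  move=> /existsNP[f /not_implyP[af nf]] /existsNP[g /not_implyP[ag ng]].
  have [A [C [PA QC AC CA]]] := PQ _ (adequate_max af ag).
  have b0 : mbounded (@set0 X) by exists 0.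
  case: PA => PA; [apply: nf|apply: ng]; exists A, C; split => //.
  + apply: strongly_contained_sub AC b0 _ _; rewrite setU0.
    by apply: Uset_anti => n _; rewrite le_max lexx.
  + apply: strongly_contained_sub CA b0 _ _; rewrite setU0.
    by apply: Uset_anti => n _; rewrite le_max lexx.
  + apply: strongly_contained_sub AC b0 _ _; rewrite setU0.
    by apply: Uset_anti => n _; rewrite le_max lexx orbT.
  + apply: strongly_contained_sub CA b0 _ _; rewrite setU0.
    by apply: Uset_anti => n _; rewrite le_max lexx orbT.
- move=> P Q PQ.
  have : adequate (fun n => (n * n + n + n)%:R : R).
    split=> [n n1|n n1]; first by rewrite ltr0n; case: n n1.
    case: n n1 => [//|n] _ /=; rewrite -natr1 !natrD !natrM -natr1.
    have : 0 <= n%:R :> R by [].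
    lra.
  by move=> /PQ[A [C [PA QC _ _]]]; split; [exists A|exists C].
- move=> P Q /existsNP[f /not_implyP[af nf]].
  pose g n := f n.*2 + n%:R.
  have ag : adequate g := adequate_double af.
  exists [set E | exists2 C : hyperspace_infty X, Q C &
    strongly_contained (val E) (Uset x0 (val C) g) /\
    strongly_contained (val C) (Uset x0 (val E) g)].
  split=> [|] /(_ g ag).
    move=> [A [E [PA [C QC [EC CE]] AE EA]]]; apply: nf.
    exists A, C; split => //.
      exact: strongly_contained_trans AE EC.
    exact: strongly_contained_trans CE EA.
  by move=> [E [C [nE QC EC CE]]]; apply: nE; exists C.
- move=> P Q [A [PA QA]] f af; exists A, A; split => //;
    exact: strongly_contained_Uset.
Defined.

Definition phi_rel (X : metricType R) (A C : hyperspace_infty X) : bool :=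
  `[< phi (val A) (val C) >].

Lemma phi_rel_equiv (X : metricType R) : equiv_class_of (@phi_rel X).
Proof.
split=> [A|A C|C A E]; first by apply/asboolP; exact: phi_refl.
  by apply/asboolP/asboolP => /phi_sym.
by move=> /asboolP h1 /asboolP h2; apply/asboolP; exact: phi_trans h1 h2.
Qed.

Canonical phi_equiv (X : metricType R) := EquivRelPack (@phi_rel_equiv X).

Definition boundary (X : metricType R) : choiceType :=
  {eq_quot (phi_equiv X)}.

Definition boundary_class (X : metricType R) (A : hyperspace_infty X) :
  boundary X := \pi_{eq_quot (phi_equiv X)} A.

Lemma boundary_classP (X : metricType R) (A C : hyperspace_infty X) :
  boundary_class A = boundary_class C <-> phi (val A) (val C).
Proof. by split=> [/eqquotP/asboolP|h]; last by apply/eqquotP/asboolP. Qed.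

Lemma boundary_class_surj (X : metricType R) (c : boundary X) :
  exists A : hyperspace_infty X, boundary_class A = c.
Proof. by exists (repr c); rewrite /boundary_class reprK. Qed.

Definition boundary_proximity (X : metricType R) (x0 : X) :
    proximity (boundary X) :=
  quotient_proximity (hyperspace_proximity x0) (@boundary_class X).

End boundary.

Section coarse_maps.
Context {R : realType}.

Definition coarse_proximity_map (X Y : metricType R) (f : X -> Y) : Prop :=
  (forall A, mbounded A -> mbounded (f @` A)) /\
  (forall A B, coarse_near A B -> coarse_near (f @` A) (f @` B)).

Definition close (X Y : metricType R) (f g : X -> Y) : Prop :=
  forall A, phi (f @` A) (g @` A).

Definition proximally_coarse_equivalent (X Y : metricType R) : Prop :=
  exists (f : X -> Y) (g : Y -> X),
    [/\ coarse_proximity_map f, coarse_proximity_map g,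
        close (g \o f) id & close (f \o g) id].

End coarse_maps.

(* Main.v *)
(** A coarse proximity map [f] that reflects boundedness is bornologous:
    otherwise one finds sequences [x_k], [y_k] at bounded mutual distance whose
    images run off to infinity so sparsely that the image sequences are not
    near each other.  A modulus for bornologousness and one for properness
    combine to turn an adequate sequence [k] on [Y] into an adequate [h] on [X]
    with [f (U(C,h)) ⊆ U(f C, k)], so [A ↦ f A] is a proximity map of
    hyperspaces.  It descends to the quotients since a proximity can be pulled
    back along any map, and closeness makes the descended maps of [f] and [g]
    mutually inverse. *)
Require Import Defs.
From mathcomp Require Import all_boot all_order all_algebra.
From mathcomp Require Import all_classical all_reals all_analysis.
From mathcomp Require Import lra.
Set Implicit Arguments.
Unset Strict Implicit.
Unset Printing Implicit Defensive.
Import Order.TTheory GRing.Theory Num.Theory.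
Local Open Scope classical_set_scope.
Local Open Scope ring_scope.

(** * Proximity maps between quotients and their continuity *)

Section proximity_maps.

Definition pullback_proximity (Z W : Type) (h : Z -> W) (e : proximity W) :
  proximity Z.
Proof.
exists (fun A B => e (h @` A) (h @` B)).
- by move=> A B /proxC.
- by move=> A B C; rewrite image_setU; exact: proxU.
- move=> A B /prox_neq0[[_ [x Ax _]] [_ [y By _]]].
  by split; [exists x|exists y].
- move=> A B /prox_strong[E [AE EB]]; exists (h @^-1` E); split.
    by move/(prox_sub (@subset_refl _ _) (@image_preimage_subset _ _ h E)).
  rewrite preimage_setC.
  by move/(prox_sub (@image_preimage_subset _ _ h (~` E)) (@subset_refl _ _)).
- by move=> A B [x [Ax Bx]]; apply: prox_meet; exists (h x); split; exists x.
Defined.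

(** Pulling the target quotient proximity back along [h] makes [p] a proximity map, so the quotient
    proximity on [W], being the finest such, is finer than this pullback. *)
Lemma quotient_proximity_map (Z Z' W W' : Type) (d : proximity Z)
    (d' : proximity Z') (p : Z -> W) (p' : Z' -> W') (F : Z -> Z')
    (h : W -> W') :
  proximity_map d d' F -> h \o p = p' \o F ->
  proximity_map (quotient_proximity d p) (quotient_proximity d' p') h.
Proof.
move=> dF hp.
have [_ fine] := quotient_proximityP d p.
have [p'map _] := quotient_proximityP d' p'.
apply: (fine (pullback_proximity h (quotient_proximity d' p'))).
move=> A B AB /=; rewrite !image_comp hp -!(image_comp F p').
exact/p'map/dF.
Qed.

Lemma proximity_map_continuous (Z W : choiceType) (d : proximity Z)
    (e : proximity W) (h : Z -> W) :
  proximity_map d e h ->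
  continuous (h : prox_space d -> prox_space e).
Proof.
move=> dh; apply/continuousP => U; rewrite /open/= /prox_open => oU.
apply/seteqP; split; last exact: sub_prox_closure.
move=> x xU Ux; suff : (~` U) (h x) by [].
rewrite -oU /prox_closure /=; have := dh _ _ xU; rewrite image_set1.
apply: prox_sub => // _ [z Uz <-]; exact: Uz.
Qed.

End proximity_maps.

(** * Adequate majorants, properness and [phi] *)

Section metric_coarse_maps.
Context {R : realType}.

Lemma adequate_above (s : nat -> R) :
  exists2 h, adequate h & forall n, s n <= h n.
Proof.
(* The last summand alone dominates [s n] and exceeds the increment [n + 1] demanded by adequacy. *)
pose h n := \sum_(i < n.+1) (`|s i| + i%:R + 2).
have hS n : h n.+1 = h n + (`|s n.+1| + n.+1%:R + 2) by rewrite /h big_ord_recr.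
have h0 n : 0 <= h n.
  by apply: sumr_ge0 => i _; rewrite !addr_ge0.
have t0 n : 0 <= n%:R :> R by [].
have sn n : s n <= `|s n| := ler_norm (s n).
have an n : 0 <= `|s n| := normr_ge0 (s n).
exists h.
  split=> [[//|n] _|[//|n] _] /=; rewrite hS.
    by have := h0 n; have := an n.+1; have := t0 n.+1; lra.
  by have := an n.+1; lra.
case=> [|n].
  by rewrite /h big_ord1 /=; have := sn 0%N; lra.
by rewrite hS; have := h0 n; have := sn n.+1; have := t0 n.+1; lra.
Qed.

Lemma phi_mbounded (X : metricType R) (A B : set X) :
  phi A B -> mbounded A -> mbounded B.
Proof.
move=> [AB _] bA; apply: contrapT => uB.
have /coarse_nearP[e /(_ A bA)[x [y [Ax]]]] := AB B (@subset_refl _ _) uB.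
by move=> /(_ Ax).
Qed.

Definition proper_map (X Y : metricType R) (f : X -> Y) : Prop :=
  forall A, mbounded (f @` A) -> mbounded A.

Lemma close_proper (X Y : metricType R) (f : X -> Y) (g : Y -> X) :
  (forall B, mbounded B -> mbounded (g @` B)) -> Defs.close (g \o f) id ->
  proper_map f.
Proof.
move=> gb gf A /gb; rewrite image_comp => bA.
by have := phi_mbounded (gf A) bA; rewrite image_id.
Qed.

(** An unbounded [C] inside the image of [B] is the image of its preimage in [B], which is unbounded
    because [f] preserves boundedness. *)
Lemma coarse_proximity_map_phi (X Y : metricType R) (f : X -> Y) A B :
  coarse_proximity_map f -> phi A B -> phi (f @` A) (f @` B).
Proof.
move=> [fb fn] AB.
suff H A' B' : phi A' B' -> forall C, C `<=` f @` B' -> ~ mbounded C ->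
    coarse_near (f @` A') C.
  split; first exact: H.
  move=> C CA uC; apply: coarse_nearC; exact: H (phi_sym AB) _ CA uC.
move=> [h _] C CB uC.
have EC : C = f @` (B' `&` f @^-1` C).
  apply/seteqP; split=> [y Cy|_ [x [_ Cx] <-]//].
  by have [x Bx xy] := CB _ Cy; exists x => //; split => //; rewrite /= xy.
rewrite EC; apply: fn; apply: h; first exact: subIsetl.
by move=> /fb; rewrite -EC.
Qed.

(** * Proper coarse proximity maps are bornologous *)

Section bornologous.
Context {X Y : metricType R}.
Variables (x0 : X) (y0 : Y) (f : X -> Y).
Hypotheses (f_coarse : coarse_proximity_map f) (f_proper : proper_map f).

(** If one image were within [M] of [y0], properness would confine the pair to a fixed ball, whose
    image is bounded; a large enough stretch excludes this. *)
Lemma stretched_far_pair (e M : R) :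
  (forall m, exists x y, mdist x y < e /\ m <= mdist (f x) (f y)) ->
  exists p : X * X, [/\ mdist p.1 p.2 < e, M <= mdist (f p.1) (f p.2),
    M <= mdist y0 (f p.1) & M <= mdist y0 (f p.2)].
Proof.
move=> stretch; have [fb _] := f_coarse.
have [r Br] : exists r, f @^-1` ball y0 M `<=` ball x0 r.
  apply/(mboundedP x0)/f_proper/(mboundedP y0); exists M.
  exact: image_preimage_subset.
have [s Bs] : exists s, f @` ball x0 (r + `|e|) `<=` ball y0 s.
  by apply/(mboundedP y0)/fb/(mboundedP x0); exists (r + `|e|).
have [x [y [xye Mxy]]] := stretch (Num.max M (s + s)).
have e0 := normr_ge0 e; have ee := ler_norm e.
have inner u v : mdist u v < e -> s + s <= mdist (f u) (f v) ->
    M <= mdist y0 (f u).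
  move=> uve suv; rewrite leNgt; apply/negP => uM.
  have ur : ball x0 r u by apply: Br; rewrite /= ballEmdist.
  move: ur; rewrite ballEmdist/= => ur.
  have /Bs : (f @` ball x0 (r + `|e|)) (f u).
    by exists u => //; rewrite ballEmdist/=; lra.
  have /Bs : (f @` ball x0 (r + `|e|)) (f v).
    exists v => //; rewrite ballEmdist/=.
    by have := metric_triangle x0 u v; lra.
  rewrite !ballEmdist/=; have := metric_triangle (f u) y0 (f v).
  rewrite (metric_sym (f u) y0); lra.
move: Mxy; rewrite ge_max => /andP[Mxy sxy].
exists (x, y); split => //=; first exact: inner xye sxy.
by apply: (inner y x); rewrite metric_sym.
Qed.

Lemma bornologous (e : R) :
  exists m, forall x y, mdist x y < e -> mdist (f x) (f y) < m.
Proof.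
apply: contrapT => nb; have [fb fn] := f_coarse.
have stretch m : exists x y, mdist x y < e /\ m <= mdist (f x) (f y).
  apply: contrapT => h; apply: nb; exists m => x y xye.
  by rewrite ltNge; apply/negP => mxy; apply: h; exists x, y.
have /choice[p pP] := fun M => stretched_far_pair M stretch.
(* Each pair is chosen beyond all the previous ones, by a growing margin. *)
pose size_at M := Num.max (mdist y0 (f (p M).1)) (mdist y0 (f (p M).2)).
pose M := fix M k := if k is k'.+1 then size_at (M k') + k'.+1%:R else 0.
pose x k := (p (M k)).1; pose y k := (p (M k)).2.
have xM k : M k <= mdist y0 (f (x k)) by have [] := pP (M k).
have yM k : M k <= mdist y0 (f (y k)) by have [] := pP (M k).
have xS k : mdist y0 (f (x k)) + k.+1%:R <= M k.+1.
  by rewrite /= lerD2r /size_at le_max lexx.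
have yS k : mdist y0 (f (y k)) + k.+1%:R <= M k.+1.
  by rewrite /= lerD2r /size_at le_max lexx orbT.
have t0 n : 0 <= n%:R :> R by [].
have M_S k : M k <= M k.+1.
  by have := xM k; have := xS k; have := t0 k.+1; lra.
have M_homo : {homo M : j k / (j <= k)%N >-> j <= k}.
  by apply: homo_leq => //; exact: le_trans.
have M_ge k : k%:R <= M k.
  by case: k => [//|k]; have := xS k; have := mdist_ge0 y0 (f (x k)); lra.
(* The last margin before [M k] already equals [k]: if [j] is not the predecessor of [k], then [u]
   is no farther from [y0] than the image of the preceding [x]. *)
have far_lt j k u v : (j < k)%N -> mdist y0 u + j.+1%:R <= M j.+1 ->
    M k <= mdist y0 v -> k%:R <= mdist u v.
  case: k => // k; rewrite ltnS leq_eqVlt => jk uj vk.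
  suff ukM : mdist y0 u + k.+1%:R <= M k.+1.
    by have := metric_triangle y0 u v; lra.
  case/orP: jk => [/eqP <-//|/M_homo jk].
  by have := xM k; have := xS k; have := t0 j.+1; lra.
have far_xy j k : j%:R <= mdist (f (x j)) (f (y k)) /\
    k%:R <= mdist (f (x j)) (f (y k)).
  have [jk|kj|->] := ltngtP j k.
  - have kxy := far_lt _ _ _ _ jk (xS j) (yM k); split => //.
    by apply: le_trans kxy; rewrite ler_nat ltnW.
  - have jxy := far_lt _ _ _ _ kj (yS k) (xM j); rewrite metric_sym.
    by split => //; apply: le_trans jxy; rewrite ler_nat ltnW.
  - by have [_ Mxy _ _] := pP (M k); have := M_ge k; rewrite /x /y; lra.
(* The pairs leave every bounded [D], since their images leave the bounded image of [D]. *)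
have xy_near : coarse_near (range x) (range y).
  apply/coarse_nearP; exists e => D /fb /(mboundedP y0)[s Ds].
  pose k := (Num.truncn `|s|).+1.
  have sk : s <= k%:R by apply: le_trans (ler_norm s) (ltW (truncnS_gt _)).
  have nD z : M k <= mdist y0 (f z) -> ~ D z.
    move=> zM Dz; have /Ds : (f @` D) (f z) by exists z.
    by rewrite ballEmdist/=; have := M_ge k; lra.
  exists (x k), (y k); split; [by exists k| |by exists k| |].
  - exact/nD/xM.
  - exact/nD/yM.
  - by have [] := pP (M k).
have /coarse_nearP[eps near_f] := fn _ _ xy_near.
pose N := (Num.truncn `|eps|).+1.
have epsN : eps <= N%:R by apply: le_trans (ler_norm _) (ltW (truncnS_gt _)).
(* This ball contains all image points of index at most [N], so by [far_xy] those left outside are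
   at least [eps] apart. *)
have bD : mbounded (ball y0 (M N.+1)) by apply/(mboundedP y0); exists (M N.+1).
have big j z : mdist y0 z + j.+1%:R <= M j.+1 -> ~ ball y0 (M N.+1) z ->
    (N < j)%N.
  move=> zj; rewrite ltnNge; apply: contra_notN => jN.
  rewrite ballEmdist/mkset; have := M_homo j.+1 N.+1 jN.
  by have := ltr0Sn R j; lra.
have [_ [_ [[_ [j _ <-] <-] xD [_ [k _ <-] <-] yD fxy]]] := near_f _ bD.
have := big _ _ (xS j) xD => Nj; have [jxy _] := far_xy j k.
have NjR : N%:R <= j%:R :> R by rewrite ler_nat ltnW.
lra.
Qed.

(** * Images of the neighbourhoods [Uset] *)

Lemma Uset_image (k : nat -> R) : adequate k ->
  exists2 h, adequate h &
    forall C, f @` Uset x0 C h `<=` Uset y0 (f @` C) k.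
Proof.
move=> ak.
(* Layer [n] of a [Uset] will be sent into layer [rho n]; layers are indexed from 1. *)
have rho_ex (n : nat) : exists m : nat, (1 <= m)%N /\
    forall x y, mdist x y < n%:R -> mdist (f x) (f y) < m%:R.
  have [m mP] := bornologous n%:R; exists (Num.truncn `|m|).+1; split => //.
  move=> x y /mP/lt_trans; apply; apply: le_lt_trans (truncnS_gt _).
  exact: ler_norm.
have /choice[rho rhoP] := rho_ex.
have s_ex (n : nat) : exists s : R,
    f @^-1` ball y0 (k (rho n)) `<=` ball x0 s.
  apply/(mboundedP x0)/f_proper/(mboundedP y0); exists (k (rho n)).
  exact: image_preimage_subset.
have /choice[s sP] := s_ex; have [h ah sh] := adequate_above s.
exists h => // C _ [x [Cx|[n n1 [[c Cc cx] hx]]] <-].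
  by left; exists x.
have [rho1 rhoc] := rhoP n.
right; exists (rho n) => //; split.
  exists (f c); first by exists c.
  by move: cx; rewrite !ballEmdist/=; exact: rhoc.
move=> kx; apply: hx; have := sP n x kx; rewrite !ballEmdist/=.
by move/lt_le_trans; apply.
Qed.

(** Strong containment is weakened to inclusion up to a bounded set, which [f] transports. Strength
    is recovered because the image of [A] is strongly contained in its own [Uset] for the doubled
    sequence, and [Uset_Uset] absorbs that second enlargement. *)
Lemma strongly_contained_image (k : nat -> R) : adequate k ->
  exists2 h, adequate h & forall A C, strongly_contained A (Uset x0 C h) ->
    strongly_contained (f @` A) (Uset y0 (f @` C) k).
Proof.
move=> ak; have [fb _] := f_coarse.
have [h ah hU] := Uset_image (adequate_double ak).
exists h => // A C /strongly_contained_mod[D bD AC].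
have fAC : f @` A `<=` Uset y0 (f @` C) (fun n => k n.*2 + n%:R) `|` f @` D.
  move=> _ [x /AC[Ux|Dx] <-]; last by right; exists x.
  by left; apply: hU; exists x.
have [D' bD' sub] := Uset_Uset ak (fb _ bD) fAC.
exact: strongly_contained_sub (@strongly_contained_Uset _ _ _ _ _) bD' _ sub.
Qed.

(** * Induced maps on hyperspaces and boundaries *)

Lemma image_infty (A : hyperspace_infty X) :
  f @` val A \in [set B : set Y | ~ mbounded B].
Proof. by apply/mem_set => /f_proper; exact: (set_mem (valP A)). Qed.

Definition hyperspace_image (A : hyperspace_infty X) : hyperspace_infty Y :=
  exist _ (f @` val A) (image_infty A).

Lemma hyperspace_image_map : proximity_map (hyperspace_proximity x0)
  (hyperspace_proximity y0) hyperspace_image.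
Proof.
move=> P Q PQ k ak; have [h ah hU] := strongly_contained_image ak.
have [A [C [PA QC AC CA]]] := PQ h ah.
exists (hyperspace_image A), (hyperspace_image C).
by split; [exists A|exists C|exact: hU|exact: hU].
Qed.

(** The choice of representative is immaterial, by [boundary_map_class]. *)
Definition boundary_map (c : boundary X) : boundary Y :=
  boundary_class (hyperspace_image (repr c)).

Lemma boundary_map_class A :
  boundary_map (boundary_class A) = boundary_class (hyperspace_image A).
Proof.
apply/boundary_classP; apply: coarse_proximity_map_phi => //.
by apply/boundary_classP; rewrite /boundary_class reprK.
Qed.

Lemma boundary_map_proximity : proximity_map (boundary_proximity x0)
  (boundary_proximity y0) boundary_map.
Proof.
apply: quotient_proximity_map hyperspace_image_map _.
by apply/funext => A; exact: boundary_map_class.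
Qed.

End bornologous.

Lemma boundary_map_cancel (X Y : metricType R) (f : X -> Y) (g : Y -> X)
    (fc : coarse_proximity_map f) (fp : proper_map f)
    (gc : coarse_proximity_map g) (gp : proper_map g) :
  Defs.close (g \o f) id -> cancel (boundary_map fp) (boundary_map gp).
Proof.
move=> gf c; have [A <-] := boundary_class_surj c.
rewrite !boundary_map_class//; apply/boundary_classP.
by have := gf (val A); rewrite image_id -image_comp.
Qed.

End metric_coarse_maps.

Theorem corollary8p25 (R : realType) (X Y : metricType R) (x0 : X) (y0 : Y)
    (X_unbounded : ~ mbounded [set: X]%classic)
    (Y_unbounded : ~ mbounded [set: Y]%classic)
    (XY_equivalent : proximally_coarse_equivalent X Y) :
  proximally_isomorphic (boundary_proximity x0) (boundary_proximity y0) /\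
  homeomorphic (prox_space (boundary_proximity x0))
               (prox_space (boundary_proximity y0)).
Proof.
have [f [g [fc gc gf fg]]] := XY_equivalent.
(* Each map is proper because the other one preserves boundedness. *)
have fp : proper_map f := close_proper gc.1 gf.
have gp : proper_map g := close_proper fc.1 fg.
have hK := boundary_map_cancel fc fp gc gp gf.
have kK := boundary_map_cancel gc gp fc fp fg.
have hP := @boundary_map_proximity _ _ _ x0 y0 _ fc fp.
have kP := @boundary_map_proximity _ _ _ y0 x0 _ gc gp.
split; first by exists (boundary_map fp); split => //; exists (boundary_map gp).
exists (boundary_map fp), (boundary_map gp).
by split => //; exact: proximity_map_continuous.
Qed.
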